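(* Let $L=K_1\cup K_2$ and $L'=K_1'\cup K_2'$ be $2$-component odd virtual links. Then the following are equivalent. (i) $L$ and $L'$ are related by a finite sequence of $\Xi$-moves (that is, $L$ and $L'$ are $\Xi$-equivalent). (ii) ${\rm Lk}(K_1,K_2)={\rm Lk}(K_1',K_2')$ and ${\rm Lk}(K_2,K_1)={\rm Lk}(K_2',K_1')$.
   Context: Gauss diagrams. A ($2$-component) Gauss diagram $G$ consists of two disjoint oriented circles $C_1,C_2$ (ordered) and finitely many chords. Each chord has a sign $\pm1$ and is oriented from an initial endpoint to a terminal endpoint; all endpoints are distinct points of $C_1\cup C_2$. Only the cyclic order of the endpoints on each oriented circle matters. A chord is a self-chord if both endpoints lie on the same circle, and a nonself-chord otherwise; a nonself-chord is of type $(i,j)$ if it is oriented from $C_i$ to $C_j$. Endpoints on one circle are consecutive (adjacent) if they lie on an arc of it containing no other endpoints. Reidemeister moves. R1: add or delete a self-chord (any sign, any orientation) whose two endpoints are adjacent. R2: add or delete two chords of opposite signs whose two initial endpoints are adjacent on an arc and whose two terminal endpoints are adjacent on another, disjoint arc (in either order at each place). R3: suppose there are pairwise disjoint arcs $I_t,I_m,I_b$ of the circles whose only endpoints are those of three chords $x$ (from $I_t$ to $I_m$), $y$ (from $I_t$ to $I_b$), $z$ (from $I_m$ to $I_b$), with signs $s_x,s_y,s_z$. Let $\varepsilon_t=+1$ if the endpoint of $x$ precedes that of $y$ on $I_t$ along the orientation, $\varepsilon_m=+1$ if $x$ precedes $z$ on $I_m$, $\varepsilon_b=+1$ if $y$ precedes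 $z$ on $I_b$, and $-1$ otherwise. If for some $\tau\in\{\pm1\}$ we have $\varepsilon_t=\tau s_xs_ys_z$, $\varepsilon_m=\tau s_x$, $\varepsilon_b=\tau s_y$, then the move exchanges the two endpoints on each of the three arcs. A $2$-component virtual link $L=K_1\cup K_2$ is an equivalence class of Gauss diagrams under R1–R3 (equivalently, of virtual link diagrams under generalized Reidemeister moves); the component $K_i$ corresponds to $C_i$. $\Xi$-move: for three consecutive endpoints $P_1,P_2,P_3$ on one circle (of chords with arbitrary signs and orientations, some of which may coincide), exchange the positions of $P_1$ and $P_3$, keeping signs and orientations of chords. Two Gauss diagrams are $\Xi$-equivalent if they are related by a finite sequence of R1–R3 and $\Xi$-moves; two virtual links are $\Xi$-equivalent (related by a finite sequence of $\Xi$-moves) if their Gauss diagrams are. Linking numbers. For $\{i,j\}=\{1,2\}$, ${\rm Lk}(K_i,K_j)$ is the sum of signs of all nonself-chords of type $(i,j)$ in a Gauss diagram of $L$; it is an invariant of $L$. $L$ is odd (resp. even) if ${\rm Lk}(K_1,K_2)+{\rm Lk}(K_2,K_1)$ is odd (resp. even), equivalently if the number of nonself-chords in any Gauss diagram of $L$ is odd (resp. even). *)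

(* Defs.v *)
From HB Require Import structures.
From mathcomp Require Import all_boot all_order all_algebra.
From mathcomp Require Import generic_quotient boolp.
From Stdlib Require Import Relations.Relation_Operators.

Set Implicit Arguments.
Unset Strict Implicit.
Unset Printing Implicit Defensive.

Import GRing.Theory.
Local Open Scope ring_scope.
Local Open Scope quotient_scope.

(* A boolean sign: [true] is [+1], [false] is [-1]. *)
Definition sgn (b : bool) : int := if b then 1 else -1.

(* A chord is a name together with its sign; chords with the same name and
   different signs are different chords. *)
Definition chord : Type := (nat * bool)%type.
Definition sign (c : chord) : int := sgn c.2.

Definition endpoint : Type := (chord * bool)%type.
Definition init (c : chord) : endpoint := (c, true).
Definition term (c : chord) : endpoint := (c, false).
Definition other_end (e : endpoint) : endpoint := (e.1, ~~ e.2).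

Inductive component := C1 | C2.

(* The endpoints met along each of the two oriented circles, read from an
   arbitrary base point; base points are forgotten by [diagram_iso] below. *)
Definition code : Type := (seq endpoint * seq endpoint)%type.

Definition circle (D : code) (i : component) : seq endpoint :=
  match i with C1 => D.1 | C2 => D.2 end.

Definition endpoints (D : code) : seq endpoint := D.1 ++ D.2.

Definition chords (D : code) : seq chord :=
  [seq e.1 | e <- endpoints D & e.2].

Definition wf_code (D : code) : bool :=
  uniq (endpoints D)
  && all (fun e => other_end e \in endpoints D) (endpoints D).

Record gauss_diagram := GaussDiagram {
  gd_code :> code;
  gd_wf : wf_code gd_code }.

HB.instance Definition _ := [isSub for gd_code].
HB.instance Definition _ := [Choice of gauss_diagram by <:].

(* [b] comes immediately after [a] on one of the oriented circles. *)
Definition follows (D : code) (a b : endpoint) : Prop :=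
  exists i, (a \in circle D i) && (next (circle D i) a == b).

Definition adjacent (D : code) (a b : endpoint) : Prop :=
  follows D a b \/ follows D b a.

(* [a], [b] are the two endpoints of an arc; [a] precedes [b] iff [eps]. *)
Definition arc_order (D : code) (eps : bool) (a b : endpoint) : Prop :=
  if eps then follows D a b else follows D b a.

Definition map_code (f : endpoint -> endpoint) (D : code) : code :=
  (map f D.1, map f D.2).

Definition erase (cs : seq chord) (D : code) : code :=
  ([seq e <- D.1 | e.1 \notin cs], [seq e <- D.2 | e.1 \notin cs]).

Definition swap (a b e : endpoint) : endpoint :=
  if e == a then b else if e == b then a else e.

(* Equality of Gauss diagrams: change of base points and of chord names. *)
Definition diagram_iso (D D' : code) : Prop :=
  exists (k1 k2 : nat) (f : chord -> chord),
    [/\ {in chords D &, injective f},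
        {in chords D, forall c, sign (f c) = sign c}
      & D' = map_code (fun e => (f e.1, e.2)) (rot k1 D.1, rot k2 D.2)].

Definition R1_delete (D D' : code) : Prop :=
  exists c : chord, adjacent D (init c) (term c) /\ D' = erase [:: c] D.

(* The two arcs are automatically disjoint: their four ends are distinct and
   neither arc contains a further endpoint. *)
Definition R2_delete (D D' : code) : Prop :=
  exists c d : chord,
    [/\ sign c = - sign d,
        adjacent D (init c) (init d),
        adjacent D (term c) (term d)
      & D' = erase [:: c; d] D].

Definition R3 (D D' : code) : Prop :=
  exists x y z : chord, exists tau et em eb : bool,
    [/\ uniq [:: x; y; z],
        [/\ arc_order D et (init x) (init y),
            arc_order D em (term x) (init z)
          & arc_order D eb (term y) (term z)],
        [/\ sgn et = sgn tau * sign x * sign y * sign z,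
            sgn em = sgn tau * sign x
          & sgn eb = sgn tau * sign y]
      & D' = map_code (swap (init x) (init y) \o swap (term x) (init z)
                         \o swap (term y) (term z)) D].

Definition Xi_move (D D' : code) : Prop :=
  exists p1 p2 p3 : endpoint,
    [/\ uniq [:: p1; p2; p3], follows D p1 p2, follows D p2 p3
      & D' = map_code (swap p1 p3) D].

Definition reidemeister_step (G H : gauss_diagram) : Prop :=
  diagram_iso G H \/ R1_delete G H \/ R2_delete G H \/ R3 G H.

Definition reidemeister_equiv : gauss_diagram -> gauss_diagram -> Prop :=
  clos_refl_sym_trans _ reidemeister_step.

Definition Xi_equiv_diagrams : gauss_diagram -> gauss_diagram -> Prop :=
  clos_refl_sym_trans _ (fun G H => reidemeister_step G H \/ Xi_move G H).

(* The virtual links are the classes of Gauss diagrams. *)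
Definition reidemeister_rel : rel gauss_diagram :=
  fun G H => `[< reidemeister_equiv G H >].

Lemma reidemeister_rel_refl : reflexive reidemeister_rel.
Proof. by move=> G; apply/asboolP; apply: rst_refl. Qed.

Lemma reidemeister_rel_sym : symmetric reidemeister_rel.
Proof. by move=> G H; apply/asboolP/asboolP; apply: rst_sym. Qed.

Lemma reidemeister_rel_trans : transitive reidemeister_rel.
Proof.
by move=> H G K /asboolP GH /asboolP HK; apply/asboolP; apply: rst_trans HK.
Qed.

Canonical reidemeister_equiv_rel :=
  EquivRel reidemeister_rel reidemeister_rel_refl reidemeister_rel_sym
    reidemeister_rel_trans.

Definition virtual_link := {eq_quot reidemeister_equiv_rel}.

Definition link_of (G : gauss_diagram) : virtual_link := \pi_virtual_link G.

Definition Xi_equiv (L L' : virtual_link) : Prop :=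
  exists G G' : gauss_diagram,
    [/\ link_of G = L, link_of G' = L' & Xi_equiv_diagrams G G'].

(* Only used for [i <> j]. *)
Definition lk (D : code) (i j : component) : int :=
  \sum_(c <- chords D | (init c \in circle D i) && (term c \in circle D j))
    sign c.

(* [Lk] is read off a chosen diagram of [L]; for [i <> j] the choice is
   irrelevant, see [Lk_link_of]. *)
Definition Lk (L : virtual_link) (i j : component) : int := lk (repr L) i j.

Definition odd_link (L : virtual_link) : Prop :=
  ~~ (2 %| Lk L C1 C2 + Lk L C2 C1)%Z.

Lemma link_ofP G H : link_of G = link_of H <-> reidemeister_equiv G H.
Proof.
split=> [/eqmodP/asboolP //|GH].
by apply/eqmodP/asboolP.
Qed.

Lemma mem_chords D c : (c \in chords D) = (init c \in endpoints D).
Proof.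
apply/mapP/idP => [[[c' b]]|cD].
  by rewrite mem_filter /= => /andP[]; case: b => // _ cD ->.
by exists (init c); rewrite // mem_filter.
Qed.

Lemma chords_uniq D : uniq (endpoints D) -> uniq (chords D).
Proof.
move=> uD; rewrite map_inj_in_uniq ?filter_uniq // => -[c b] [c' b'].
by rewrite !mem_filter /= => /andP[-> _] /andP[-> _] ->.
Qed.

Lemma mem_endpoints D e :
  (e \in endpoints D) = (e \in circle D C1) || (e \in circle D C2).
Proof. by rewrite mem_cat. Qed.

Lemma circle_endpoints D i e : e \in circle D i -> e \in endpoints D.
Proof. by rewrite mem_endpoints; case: i => ->; rewrite ?orbT. Qed.

Lemma circle_disj (G : gauss_diagram) i j e :
  e \in circle G i -> e \in circle G j -> i = j.
Proof.
have /andP[+ _] := gd_wf G; rewrite cat_uniq => /and3P[_ /hasPn dG _].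
by case: i; case: j => //= e1 e2; [have := dG _ e2|have := dG _ e1];
  rewrite /= ?e1 ?e2.
Qed.

Lemma eq_lk (G H : gauss_diagram) i j :
  (forall k, circle G k =i circle H k) -> lk G i j = lk H i j.
Proof.
move=> GH; rewrite /lk.
have pGH : perm_eq (chords G) (chords H).
  apply: uniq_perm; last by move=> c; rewrite !mem_chords !mem_endpoints !GH.
    by have /andP[/chords_uniq] := gd_wf G.
  by have /andP[/chords_uniq] := gd_wf H.
by rewrite (perm_big _ pGH) /=; apply: eq_bigl => c; rewrite !GH.
Qed.

Lemma follows_circle (G : gauss_diagram) a b i :
  follows G a b -> (a \in circle G i) = (b \in circle G i).
Proof.
case=> k /andP[ak /eqP ab].
have bk : b \in circle G k by rewrite -ab mem_next.
by apply/idP/idP => [/(circle_disj ak)|/(circle_disj bk)] <-.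
Qed.

Lemma adjacent_circle (G : gauss_diagram) a b i :
  adjacent G a b -> (a \in circle G i) = (b \in circle G i).
Proof. by case=> /follows_circle ->. Qed.

Lemma follows_mem D a b : follows D a b ->
  (a \in endpoints D) && (b \in endpoints D).
Proof.
case=> k /andP[ak /eqP <-]; apply/andP.
by split; apply: (@circle_endpoints _ k); rewrite ?mem_next.
Qed.

Lemma adjacent_mem D a b : adjacent D a b ->
  (a \in endpoints D) && (b \in endpoints D).
Proof. by case=> /follows_mem // /andP[-> ->]. Qed.

Lemma swapK a b : involutive (swap a b).
Proof.
move=> e; rewrite /swap; have [->|ea] := eqVneq e a.
  by rewrite eqxx; case: eqP.
by have [->|eb] := eqVneq e b; rewrite ?eqxx // (negPf ea) (negPf eb).
Qed.

Lemma mem_swap (G : gauss_diagram) a b i e :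
  (a \in circle G i) = (b \in circle G i) ->
  (swap a b e \in circle G i) = (e \in circle G i).
Proof. by rewrite /swap; case: eqP => [->|_] //; case: eqP => [->|_]. Qed.

Lemma arc_order_circle (G : gauss_diagram) eps a b i :
  arc_order G eps a b -> (a \in circle G i) = (b \in circle G i).
Proof. by case: eps => /follows_circle ->. Qed.

Lemma circle_map f D i : circle (map_code f D) i = map f (circle D i).
Proof. by case: i. Qed.

Lemma circle_erase cs D i :
  circle (erase cs D) i = [seq e <- circle D i | e.1 \notin cs].
Proof. by case: i. Qed.

Lemma lk_erase cs (G : gauss_diagram) i j :
  uniq cs -> {subset cs <= chords G} ->
  lk G i j = lk (erase cs G) i j
    + \sum_(c <- cs | (init c \in circle G i) && (term c \in circle G j)) sign c.
Proof.
move=> ucs csG; rewrite /lk.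
have uG : uniq (chords G) by have /andP[/chords_uniq] := gd_wf G.
have chE : chords (erase cs G) = [seq c <- chords G | c \notin cs].
  rewrite /chords /endpoints /erase /= -filter_cat [in RHS]filter_map.
  by congr map; rewrite -!filter_predI; apply: eq_filter => e /=; rewrite andbC.
have /(perm_big _) -> : perm_eq (chords G)
    ([seq c <- chords G | c \notin cs] ++ cs).
  apply: uniq_perm => //.
    rewrite cat_uniq filter_uniq // ucs andbT /=.
    by apply/hasPn => c; rewrite mem_filter /= => ->.
  move=> c; rewrite mem_cat mem_filter orbC; have [/csG->|] //= := boolP (_ \in cs).
rewrite big_cat chE /=; congr (_ + _).
rewrite !big_filter_cond; apply: eq_bigl => c.
by rewrite !circle_erase !mem_filter /=; case: (c \in cs).
Qed.

Lemma lk_step (G H : gauss_diagram) i j :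
  i <> j -> reidemeister_step G H -> lk G i j = lk H i j.
Proof.
move=> ij [[k1 [k2 [f [finj fs HE]]]]|[[c [cc HE]]|[[c [d [cd ii tt HE]]]|]]].
- pose D : code := (rot k1 (gd_code G).1, rot k2 (gd_code G).2).
  have memD k : circle D k =i circle G k by case: k => e; rewrite /= mem_rot.
  have wfD : wf_code D.
    have pD : perm_eq (endpoints D) (endpoints G).
      by apply: perm_cat; rewrite perm_rot.
    rewrite /wf_code (perm_uniq pD) (perm_all _ pD).
    rewrite (@eq_all _ _ (fun e => other_end e \in endpoints G)); first exact: (gd_wf G).
    by move=> e; rewrite (perm_mem pD).
  have -> : lk G i j = lk D i j.
    by apply: (@eq_lk G (GaussDiagram wfD)) => k e; rewrite memD.
  rewrite HE -/D /lk.
  set g := fun e : endpoint => (f e.1, e.2).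
  have -> : chords (map_code g D) = map f (chords D).
    rewrite /chords /endpoints /map_code /= -map_cat filter_map -!map_comp.
    by congr map.
  rewrite [RHS]big_map.
  have cG e : e \in endpoints D -> e.1 \in chords G.
    move=> eD; have eG : e \in endpoints G.
      by move: eD; rewrite !mem_endpoints !memD.
    rewrite mem_chords; case: e eG {eD} => e [] // eG.
    by have /andP[_ /allP/(_ _ eG)] := gd_wf G.
  have ming k e : e \in endpoints D ->
      (g e \in map g (circle D k)) = (e \in circle D k).
    move=> eD; apply/mapP/idP => [[e' e'D]|eDk]; last by exists e.
    case: e e' eD e'D => [e b] [e' b'] eD e'D /= [ee' ->].
    rewrite (finj _ _ _ _ ee') //; first exact: (cG (e, b)).
    exact: (cG (e', b') (circle_endpoints e'D)).
  have inE : {in chords D, forall c, init c \in endpoints D /\ term c \in endpoints D}.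
    move=> c; rewrite mem_chords => cD; split=> //.
    by have /andP[_ /allP/(_ _ cD)] := wfD.
  rewrite [LHS]big_seq_cond [RHS]big_seq_cond.
  apply: eq_big => [c|c /andP[cD _]].
    case: (boolP (c \in chords D)) => //= /inE[ic tc].
    by rewrite !circle_map -(ming i _ ic) -(ming j _ tc).
  by rewrite fs //; apply: (cG (init c)); case: (inE _ cD).
- have /andP[cG _] := adjacent_mem cc.
  rewrite (@lk_erase [:: c]) //; last first.
    by move=> x; rewrite inE => /eqP->; rewrite mem_chords.
  rewrite -HE big_cons big_nil (adjacent_circle _ cc).
  case: ifP => [/andP[ci cj]|_]; last by rewrite addr0.
  by case: ij; apply: circle_disj ci cj.
- have /andP[cG dG] := adjacent_mem ii.
  rewrite (@lk_erase [:: c; d]) //=; last first.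
  - by move=> x; rewrite !inE => /orP[]/eqP->; rewrite mem_chords.
  - rewrite inE andbT; apply/eqP => cdE; move: cd; rewrite cdE /sign.
    by case: d.2.
  rewrite -HE !big_cons big_nil (adjacent_circle _ ii) (adjacent_circle _ tt).
  by case: ifP => h; rewrite [X in if X then _ else _]h ?cd ?addr0 ?addNr ?addr0.
case=> x [y [z [tau [et [em [eb [_ [t m b] _ HE]]]]]]].
apply: eq_lk => k e; rewrite HE circle_map.
set s := _ \o _ \o _.
have sK : cancel (swap (term y) (term z) \o swap (term x) (init z)
   \o swap (init x) (init y)) s.
  by move=> a; rewrite /s /= !swapK.
have sinj : injective s by do !apply: inj_comp; apply: inv_inj; apply: swapK.
have sE a : (s a \in circle G k) = (a \in circle G k).
  by rewrite /s /= !mem_swap //; apply: arc_order_circle; eauto.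
apply/idP/mapP => [ek|[a ak ->]]; last by rewrite sE.
by eexists; last exact/esym/sK; rewrite -sE sK.
Qed.

Lemma Lk_link_of (G : gauss_diagram) i j :
  i <> j -> Lk (link_of G) i j = lk G i j.
Proof.
move=> ij; rewrite /Lk.
have : reidemeister_equiv (repr (link_of G)) G.
  by apply/link_ofP; rewrite /link_of reprK.
move: (repr _) => G0; elim=> {G G0} [G H|G|G H _ ->|G H K _ -> _ ->] //.
exact: lk_step.
Qed.

(* Main.v *)
Require Import Defs.
From mathcomp Require Import all_boot all_order all_algebra.
From mathcomp Require Import generic_quotient boolp zify.
From Stdlib Require Import Relations.Relation_Operators.

Set Implicit Arguments.
Unset Strict Implicit.
Unset Printing Implicit Defensive.

Import GRing.Theory.
Local Open Scope ring_scope.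

(** On a circle with an odd number of endpoints, exchanging the endpoints in
    positions [k] and [k + 2] generates all permutations, because stepping by
    two around an odd cycle visits every position. In a diagram of an odd link
    both circles carry an odd number of endpoints, so up to Xi-moves only the
    types and signs of the chords matter: self-chords are removed by R1, pairs
    of nonself-chords of the same type and opposite signs by R2, and the chords
    left over are counted by the two linking numbers. *)

(** * Permutations of cyclic words of odd length *)

Section CyclicPermutation.

Variables (T : eqType) (R : seq T -> seq T -> Prop).
Hypotheses (R_refl : forall s, R s s)
  (R_trans : forall s t u, R s t -> R t u -> R s u)
  (R_rot : forall s t, R (s ++ t) (t ++ s))
  (R_jump : forall a b c s, R [:: a, c, b & s] [:: b, c, a & s]).

Lemma jump_cat p a b c s : R (p ++ [:: a, c, b & s]) (p ++ [:: b, c, a & s]).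
Proof.
apply: R_trans (R_rot _ _) _; apply: R_trans (R_jump _ _ _ _) _.
exact: (R_rot [:: b, c, a & s]).
Qed.

(* a c d m b, then d c a m b, then d c b m a, then b c d m a. *)
Lemma far_swap p a m b s :
  odd (size m) -> R (p ++ a :: m ++ b :: s) (p ++ b :: m ++ a :: s).
Proof.
have [n] := ubnP (size m); elim: n => // n IH in p a m b s *.
case: m => [|c [|d m]] //= mn; first by move=> _; apply: jump_cat.
rewrite negbK => om.
apply: R_trans (jump_cat _ _ _ _ _) _.
have := IH (p ++ [:: d; c]) a m b s (ltnW mn) om.
rewrite -!catA /= => /R_trans; apply; exact: jump_cat.
Qed.

(* In a cyclic word of odd length, two neighbours are also the two ends of an
   arc with an odd number of letters inside. *)
Lemma adjacent_swap p a b s :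
  odd (size (p ++ s)) -> R (p ++ [:: a, b & s]) (p ++ [:: b, a & s]).
Proof.
move=> ops; have := R_rot (p ++ [:: a]) (b :: s); rewrite -catA /= => /R_trans.
apply.
have := @far_swap [::] b (s ++ p) a [::]; rewrite /= -!catA => far.
apply: R_trans (far _) _; first by rewrite size_cat addnC -size_cat.
by have := R_rot (a :: s) (p ++ [:: b]); rewrite -catA.
Qed.

(** [a] passes the letters of [s] one at a time; the length of the whole word never changes, so
    neighbour exchanges stay available. *)
Lemma insert_swap p a s t : odd (size (p ++ a :: s ++ t)) ->
  R (p ++ a :: s ++ t) (p ++ s ++ a :: t).
Proof.
elim: s p => [|b s IH] p /=; first by move=> _; apply: R_refl.
move=> o; apply: R_trans (adjacent_swap _ _ _) _.
  by move: o; rewrite !size_cat /= !addnS /= negbK size_cat.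
have := IH (p ++ [:: b]); rewrite -!catA /=; apply.
by move: o; rewrite !size_cat /= !addnS.
Qed.

Lemma odd_cyclic_perm s t : odd (size s) -> perm_eq s t -> R s t.
Proof.
(* The prefix [p] holds the letters already set aside. Parity is assumed of the whole word, since
   the part still to be sorted changes parity at each step. *)
suff gen p : odd (size (p ++ s)) -> perm_eq s t -> R (p ++ s) (p ++ t).
  exact: (gen [::]).
elim: s p t => [|a s IH] p t o st.
  by move: st; rewrite perm_sym => /perm_nilP->; apply: R_refl.
have at' : a \in t by rewrite -(perm_mem st) mem_head.
case/splitPr: at' st => t1 t2.
rewrite perm_sym -cat_rcons -cats1 -catA perm_catCA /= perm_cons perm_sym => st.
(* The tail is sorted behind [a], which then moves past [t1] to its place. *)
have := IH (p ++ [:: a]) (t1 ++ t2); rewrite -!catA /= => /(_ o st)/R_trans.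
apply; apply: insert_swap.
by move: o; rewrite !size_cat /= (perm_size st) size_cat.
Qed.

End CyclicPermutation.

(** * Permuting the endpoints on the circles of a diagram *)

Definition code_at (i : component) (s t : seq endpoint) : code :=
  if i is C1 then (s, t) else (t, s).

Definition opp (i : component) : component := if i is C1 then C2 else C1.

Lemma perm_endpoints (D D' : code) :
  (forall i, perm_eq (circle D i) (circle D' i)) ->
  perm_eq (endpoints D) (endpoints D').
Proof. by move=> DD'; apply: perm_cat; [apply: (DD' C1)|apply: (DD' C2)]. Qed.

Lemma perm_wf (D D' : code) :
  perm_eq (endpoints D) (endpoints D') -> wf_code D -> wf_code D'.
Proof.
move=> DD' /andP[uD /allP oD]; rewrite /wf_code -(perm_uniq DD') uD.
by apply/allP => e; rewrite -!(perm_mem DD') => /oD.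
Qed.

Lemma wf_erase cs (D : code) : wf_code D -> wf_code (erase cs D).
Proof.
rewrite /wf_code /erase /endpoints /= -filter_cat => /andP[uD /allP oD].
rewrite filter_uniq //=; apply/allP => e; rewrite !mem_filter => /andP[-> eD].
exact: oD.
Qed.

Lemma wf_term (G : gauss_diagram) c :
  (term c \in endpoints G) = (init c \in endpoints G).
Proof.
by have /andP[_ /allP o] := gd_wf G; apply/idP/idP => /o.
Qed.

Lemma uniq_circle (G : gauss_diagram) i : uniq (circle G i).
Proof.
by have /andP[] := gd_wf G; rewrite cat_uniq => /and3P[? _ ?] _; case: i.
Qed.

(* Quantifying over the diagrams with code [D] makes [reach] reflexive on
   ill-formed codes as well. *)
Definition reach (D D' : code) : Prop :=
  forall G : gauss_diagram, gd_code G = D ->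
  exists2 H : gauss_diagram, gd_code H = D' & Xi_equiv_diagrams G H.

Lemma reach_refl D : reach D D.
Proof. by move=> G GD; exists G => //; apply: rst_refl. Qed.

Lemma reach_trans D D' D'' : reach D D' -> reach D' D'' -> reach D D''.
Proof.
move=> DD' DD'' G /DD'[H /DD''[K KD HK] GH].
by exists K => //; apply: rst_trans GH HK.
Qed.

Lemma reach_rot i s s' t : reach (code_at i (s ++ s') t) (code_at i (s' ++ s) t).
Proof.
move=> G GD.
have wfD : wf_code (code_at i (s' ++ s) t).
  apply: perm_wf (gd_wf G); rewrite GD; apply: perm_endpoints.
  by case: i {GD} => -[] //=; rewrite perm_catC.
exists (GaussDiagram wfD) => //; apply: rst_step; left; left.
exists (if i is C1 then size s else 0), (if i is C1 then 0 else size s), id.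
split=> //=.
rewrite GD /map_code.
have idE r : [seq (e.1, e.2) | e : endpoint <- r] = r.
  by rewrite -[RHS]map_id; apply: eq_map => -[].
by case: i {GD wfD} => /=; rewrite !idE rot0 rot_size_cat.
Qed.

Lemma reach_jump i a b c s t :
  reach (code_at i [:: a, c, b & s] t) (code_at i [:: b, c, a & s] t).
Proof.
move=> G GD.
have pD : forall k, perm_eq (circle (code_at i [:: a, c, b & s] t) k)
    (circle (code_at i [:: b, c, a & s] t) k).
  have p3 : perm_eq [:: a, c, b & s] [:: b, c, a & s].
    by rewrite (perm_catCA [:: a; c] [:: b] s) perm_cons (perm_catCA [:: a] [:: c] s).
  by case: i {GD} => -[] /=.
have wfD : wf_code (code_at i [:: b, c, a & s] t).
  by apply: perm_wf (gd_wf G); rewrite GD; apply: perm_endpoints.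
exists (GaussDiagram wfD) => //; apply: rst_step; right.
have uG : uniq ([:: a, c, b & s] ++ t).
  have /andP[u _] := gd_wf G; move: u; rewrite GD.
  by case: i {GD pD wfD} => //=; rewrite /endpoints uniq_catC.
have [ac ab cb] : [/\ a != c, a != b & c != b].
  move: uG; rewrite /= !inE !negb_or.
  by move=> /andP[/and3P[-> -> _] /andP[/andP[-> _] _]].
(* [Xi_move] renames endpoints throughout the code; as no endpoint is repeated, only the two outer
   positions of the triple are affected. *)
have fixE r : {subset r <= s ++ t} -> map (swap a b) r = r.
  move=> rs; rewrite -[RHS]map_id; apply/eq_in_map => e /rs es; rewrite /swap.
  case: eqP => [ea|_]; last case: eqP => // eb.
    by move: uG; rewrite /= !inE -ea es !orbT.
  by move: uG; rewrite /= -eb es !andbF.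
have jumpE : map (swap a b) [:: a, c, b & s] = [:: b, c, a & s].
  rewrite /= fixE => [|e]; last by rewrite mem_cat => ->.
  by rewrite /swap !eqxx [c == a]eq_sym [b == a]eq_sym (negPf ac) (negPf ab) (negPf cb).
have fixt : map (swap a b) t = t by apply: fixE => e; rewrite mem_cat orbC => ->.
have acE : (a \in [:: a, c, b & s]) && (next [:: a, c, b & s] a == c).
  by rewrite mem_head /= !eqxx.
have cbE : (c \in [:: a, c, b & s]) && (next [:: a, c, b & s] c == b).
  by rewrite !inE eqxx orbT /= [c == a]eq_sym (negPf ac) !eqxx.
exists a, c, b; split.
- by rewrite /= !inE negb_or ac ab cb.
- by rewrite GD; exists i; case: i {GD pD wfD}.
- by rewrite GD; exists i; case: i {GD pD wfD}.
- rewrite [LHS]/= GD /map_code -[in LHS]jumpE -[in LHS]fixt.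
  by case: (i).
Qed.

Lemma reach_perm i s s' t :
  odd (size s) -> perm_eq s s' -> reach (code_at i s t) (code_at i s' t).
Proof.
apply: (@odd_cyclic_perm _ (fun s s' => reach (code_at i s t) (code_at i s' t))).
- by move=> ?; apply: reach_refl.
- by move=> ? ? ?; apply: reach_trans.
- by move=> ? ?; apply: reach_rot.
- by move=> ? ? ? ?; apply: reach_jump.
Qed.

Lemma perm_Xi_equiv (G H : gauss_diagram) :
  (forall i, odd (size (circle G i))) ->
  (forall i, perm_eq (circle G i) (circle H i)) -> Xi_equiv_diagrams G H.
Proof.
move=> oG GH.
have : reach G H.
  case: (gd_code G) (gd_code H) oG GH => [s t] [s' t'] oG GH.
  apply: (@reach_trans _ (s', t)).
    exact: (@reach_perm C1 s s' t (oG C1) (GH C1)).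
  exact: (@reach_perm C2 t t' s' (oG C2) (GH C2)).
(* The diagram reached has the code of [H], hence is [H]: well-formedness is a boolean condition. *)
by case/(_ G erefl) => K /val_inj ->.
Qed.

(** * Linking numbers and the parity of the circles *)

Lemma Xi_lk (G H : gauss_diagram) i j :
  i <> j -> Xi_equiv_diagrams G H -> lk G i j = lk H i j.
Proof.
move=> ij; elim=> {G H} [G H|G|G H _ ->|G H K _ -> _ ->] // [|]; first exact: lk_step.
(* The two exchanged ends lie on one circle, so each circle keeps its set of endpoints, and [lk]
   depends on nothing else. *)
case=> a [c [b [_ ac cb HE]]]; apply: eq_lk => k e; rewrite HE circle_map.
have sE x : (swap a b x \in circle G k) = (x \in circle G k).
  by apply: mem_swap; rewrite (follows_circle _ ac); apply: follows_circle.
apply/idP/mapP => [ek|[x xk ->]]; last by rewrite sE.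
by exists (swap a b e); rewrite ?sE // swapK.
Qed.

Definition of_type (D : code) (i j : component) (c : chord) : bool :=
  (init c \in circle D i) && (term c \in circle D j).

(** Turns a count of endpoints on a circle into a count over chords, comparable with the sums
    defining [lk]. *)
Lemma circle_perm (G : gauss_diagram) i :
  perm_eq (circle G i)
    ([seq init c | c <- chords G & init c \in circle G i]
     ++ [seq term c | c <- chords G & term c \in circle G i]).
Proof.
have uc : uniq (chords G) by have /andP[/chords_uniq] := gd_wf G.
apply: uniq_perm; first exact: uniq_circle.
  rewrite cat_uniq !map_inj_uniq ?filter_uniq //; try by move=> ? ? [].
  by rewrite andbT; apply/hasPn => e /mapP[c _ ->]; apply/mapP => -[].
move=> [c b]; rewrite mem_cat; apply/idP/orP => [cG|[|]].
- have := circle_endpoints cG; case: b cG => cG cE; [left|right]; apply/mapP; exists c.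
  + by rewrite // mem_filter cG mem_chords.
  + by [].
  + by rewrite // mem_filter cG mem_chords -wf_term.
  + by [].
- by case/mapP => d; rewrite mem_filter => /andP[? _] [-> ->].
- by case/mapP => d; rewrite mem_filter => /andP[? _] [-> ->].
Qed.

Definition odd_diagram (G : gauss_diagram) : bool :=
  ~~ (2 %| lk G C1 C2 + lk G C2 C1)%Z.

Lemma mem_circle_opp (G : gauss_diagram) i e : e \in endpoints G ->
  (e \in circle G (opp i)) = (e \notin circle G i).
Proof.
rewrite mem_endpoints => eG; apply/idP/idP => [eo|].
  by apply/negP => ei; case: i eo ei => eo /(circle_disj eo).
by case: i eG => /= /orP[->|->].
Qed.

(** A self-chord has zero or two ends on circle [i]; a nonself-chord has exactly one, and
    contributes an odd number to the sum of the two linking numbers. *)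
Lemma odd_circle (G : gauss_diagram) i :
  odd (size (circle G i)) = odd_diagram G.
Proof.
have lkE : lk G C1 C2 + lk G C2 C1 = lk G i (opp i) + lk G (opp i) i.
  by case: i => //=; rewrite addrC.
rewrite /odd_diagram lkE (perm_size (circle_perm G i)) size_cat !size_map.
rewrite !size_filter -!sum1_count.
rewrite /lk [X in X + _]big_mkcond [X in _ + X]big_mkcond -big_split /=.
rewrite [X in (X + _)%N]big_mkcond [X in (_ + X)%N]big_mkcond -big_split /=.
rewrite [in LHS]big_seq [in RHS]big_seq.
(* Chord by chord, the endpoint count is odd exactly when the signed sum is not divisible by 2. *)
elim/big_rec2: _ => // c m z cG IH.
have ic : init c \in endpoints G by rewrite -mem_chords.
have tc : term c \in endpoints G by rewrite wf_term.
rewrite !mem_circle_opp // /sign /sgn.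
move: IH; case: (init c \in _); case: (term c \in _); case: c.2 => /=; lia.
Qed.

(** * Cancelling chords down to a reduced diagram *)

Definition reduced (G : gauss_diagram) : Prop :=
  (forall i c, ~~ of_type G i i c) /\
  (forall i c d, of_type G i (opp i) c -> of_type G i (opp i) d -> c.2 = d.2).

Lemma rearrange (G : gauss_diagram) i s t :
  odd_diagram G -> perm_eq (circle G i) s -> perm_eq (circle G (opp i)) t ->
  exists2 H : gauss_diagram, gd_code H = code_at i s t & Xi_equiv_diagrams G H.
Proof.
move=> oG Gs Gt.
have GD k : perm_eq (circle G k) (circle (code_at i s t) k).
  by case: i k Gs Gt => -[].
have wfD := perm_wf (perm_endpoints GD) (gd_wf G).
exists (GaussDiagram wfD) => //; apply: perm_Xi_equiv => // k.
by rewrite odd_circle.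
Qed.

Lemma perm_to_front2 (T : eqType) (a b : T) s :
  uniq s -> a != b -> a \in s -> b \in s ->
  exists r, perm_eq s [:: a, b & r].
Proof.
move=> us ab sa sb; exists (rem b (rem a s)).
rewrite (perm_trans (perm_to_rem sa)) // perm_cons perm_to_rem //.
by rewrite mem_rem_uniq // inE eq_sym ab.
Qed.

Lemma follows_front i a b s t :
  follows (code_at i [:: a, b & s] t) a b /\
  follows (code_at i t [:: a, b & s]) a b.
Proof.
have abE : (a \in [:: a, b & s]) && (next [:: a, b & s] a == b).
  by rewrite mem_head /= !eqxx.
by split; [exists i|exists (opp i)]; case: (i).
Qed.

Lemma size_erase cs c (D : code) :
  c \in chords D -> c \in cs ->
  (size (endpoints (erase cs D)) < size (endpoints D))%N.
Proof.
rewrite mem_chords /erase {1 2}/endpoints /= -filter_cat => cD ccs.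
rewrite size_filter -(count_predC (fun e => e.1 \notin cs) (D.1 ++ D.2)).
rewrite -{1}[count _ _]addn0 ltn_add2l -has_count.
by apply/hasP; exists (init c); rewrite //= ccs.
Qed.

Lemma of_type_chords (G : gauss_diagram) i j c :
  of_type G i j c -> c \in chords G.
Proof. by case/andP=> ci _; rewrite mem_chords; apply: circle_endpoints ci. Qed.

(** Each way of failing to be reduced yields a deletion once the circles are rearranged: the two
    ends of a self-chord are brought together for R1, or the initial ends and the terminal ends of
    two nonself-chords of one type and opposite signs for R2. *)
Lemma Xi_cancel (G : gauss_diagram) : odd_diagram G -> ~ reduced G ->
  exists2 H : gauss_diagram, Xi_equiv_diagrams G H
    & (size (endpoints H) < size (endpoints G))%N.
Proof.
move=> oG redG.
(* Common to both cases: [s] and [t] are the rearranged circles, [cs] the chords to delete, and [c]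
   one of them, witnessing the drop in size. *)
have erase_ok i s t cs c : perm_eq (circle G i) s -> perm_eq (circle G (opp i)) t ->
    c \in cs -> c \in chords G ->
    (forall H H' : gauss_diagram, gd_code H = code_at i s t ->
      gd_code H' = erase cs H -> reidemeister_step H H') ->
    exists2 H : gauss_diagram, Xi_equiv_diagrams G H
      & (size (endpoints H) < size (endpoints G))%N.
  move=> Gs Gt ccs cG step; have [H HE GH] := rearrange oG Gs Gt.
  have GHp : perm_eq (endpoints H) (endpoints G).
    by apply: perm_endpoints => k; rewrite HE perm_sym; case: i k {HE step} Gs Gt => -[].
  exists (GaussDiagram (wf_erase cs (gd_wf H))).
    by apply: rst_trans GH _; apply: rst_step; left; apply: step HE _.
  rewrite -(perm_size GHp); apply: size_erase ccs.
  by rewrite mem_chords (perm_mem GHp) -mem_chords.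
case/not_andP: redG => [/existsNP[i /existsNP[c /negP]]|].
  rewrite negbK => cii; have cG := of_type_chords cii; case/andP: cii => ic tc.
  have [|s Gs] := perm_to_front2 (uniq_circle G i) _ ic tc; first by rewrite xpair_eqE andbF.
  apply: (erase_ok i _ _ [:: c] c Gs (perm_refl _)); rewrite ?mem_head //.
  move=> H H' HE H'E; right; left; exists c; split=> //; left.
  by rewrite HE; case: (follows_front i (init c) (term c) s (circle G (opp i))).
case/existsNP=> i /existsNP[c /existsNP[d]].
move=> /not_implyP[cT /not_implyP[dT cd]].
have cG := of_type_chords cT; case/andP: cT dT => ic tc /andP[id td].
have cNd : c != d by apply/eqP => e; apply: cd; rewrite e.
have [|s Gs] := perm_to_front2 (uniq_circle G i) _ ic id.
  by apply: contraNneq cNd => -[->].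
have [|t Gt] := perm_to_front2 (uniq_circle G (opp i)) _ tc td.
  by apply: contraNneq cNd => -[->].
apply: (erase_ok i _ _ [:: c; d] c Gs Gt); rewrite ?mem_head //.
move=> H H' HE H'E; right; right; left; exists c, d; split=> //.
- by move: cd; rewrite /sign /sgn; case: c.2; case: d.2.
- by left; rewrite HE; case: (follows_front i (init c) (init d) s [:: term c, term d & t]).
- by left; rewrite HE; case: (follows_front i (term c) (term d) t [:: init c, init d & s]).
Qed.

Lemma Xi_odd_diagram (G H : gauss_diagram) :
  Xi_equiv_diagrams G H -> odd_diagram G = odd_diagram H.
Proof. by move=> GH; rewrite /odd_diagram !(Xi_lk _ GH). Qed.

Lemma Xi_reduce (G : gauss_diagram) : odd_diagram G ->
  exists2 H : gauss_diagram, Xi_equiv_diagrams G H & reduced H.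
Proof.
have [n] := ubnP (size (endpoints G)); elim: n => // n IH in G *.
move=> Gn oG; have [redG|nredG] := pselect (reduced G).
  by exists G => //; apply: rst_refl.
have [H GH HG] := Xi_cancel oG nredG.
have [||K HK redK] := IH H; first exact: leq_trans HG _.
  by rewrite -(Xi_odd_diagram GH).
by exists K => //; apply: rst_trans GH HK.
Qed.

(** * Reduced diagrams are determined by their linking numbers *)

Lemma sum_constant_sign (s : seq chord) :
  {in s &, forall c d, c.2 = d.2} ->
  exists b, [seq c.2 | c <- s] = nseq (size s) b /\
            \sum_(c <- s) sign c = sgn b *+ size s.
Proof.
(* For the empty list any sign serves. *)
case: s => [|c s] cst; first by exists true; rewrite big_nil mulr0n.
have cstE d : d \in c :: s -> d.2 = c.2 by move=> ds; apply: cst; rewrite ?mem_head.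
exists c.2; split.
  rewrite -(size_map snd); apply/all_pred1P/allP => b /mapP[d ds ->].
  by rewrite /= cstE.
rewrite big_seq (eq_bigr (fun=> sgn c.2)) => [|d /cstE dE]; last by rewrite /sign dE.
by rewrite -big_seq big_const_seq count_predT iter_addr_0.
Qed.

(** With no cancellation, the absolute value of the sum is the length and a nonzero sum reveals the
    common sign; different signs with equal sums force both lists to be empty. *)
Lemma eq_constant_signs (s s' : seq chord) :
  {in s &, forall c d, c.2 = d.2} -> {in s' &, forall c d, c.2 = d.2} ->
  \sum_(c <- s) sign c = \sum_(c <- s') sign c ->
  [seq c.2 | c <- s] = [seq c.2 | c <- s'].
Proof.
move=> /sum_constant_sign[b [-> ->]] /sum_constant_sign[b' [-> ->]].
case: b b' => [] [] /=; rewrite ?mulNrn ?natz => e.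
- by congr nseq; lia.
- by have [-> ->] : size s = 0%N /\ size s' = 0%N by lia.
- by have [-> ->] : size s = 0%N /\ size s' = 0%N by lia.
- by congr nseq; lia.
Qed.

Definition nonself (D : code) (i : component) : seq chord :=
  [seq c <- chords D | of_type D i (opp i) c].

Lemma reduced_circle (G : gauss_diagram) i : reduced G ->
  perm_eq (circle G i)
    (map init (nonself G i) ++ map term (nonself G (opp i))).
Proof.
case=> noself _; have oppK : opp (opp i) = i by case: i.
rewrite (perm_trans (circle_perm G i)) //.
suff [-> ->] : [seq c <- chords G | init c \in circle G i] = nonself G i /\
  [seq c <- chords G | term c \in circle G i] = nonself G (opp i) by [].
have mem_ends c : c \in chords G -> init c \in endpoints G /\ term c \in endpoints G.
  by rewrite wf_term mem_chords.
split; apply: eq_in_filter => c cG; have [ic tc] := mem_ends c cG.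
  have := noself i c; rewrite /of_type mem_circle_opp //.
  by case: (init c \in _) => //= ->.
have := noself i c; rewrite /of_type oppK mem_circle_opp //.
by case: (term c \in _); rewrite ?andbF ?andbT //= => ->.
Qed.

Lemma uniq_nonself (G : gauss_diagram) : uniq (nonself G C1 ++ nonself G C2).
Proof.
have uc : uniq (chords G) by have /andP[/chords_uniq] := gd_wf G.
rewrite cat_uniq !filter_uniq // andbT; apply/hasPn => c.
rewrite !mem_filter => /andP[/andP[ic _] _].
by apply/negP => /andP[/andP[/(circle_disj ic)]].
Qed.

Lemma mem_nonself (G : gauss_diagram) c : reduced G ->
  c \in chords G -> c \in nonself G C1 ++ nonself G C2.
Proof.
move=> redG; rewrite mem_chords mem_endpoints mem_cat => /orP[] ic; apply/orP.
  move: ic; rewrite (perm_mem (reduced_circle C1 redG)) mem_cat.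
  by case/orP=> /mapP[d ds] // [->]; left.
move: ic; rewrite (perm_mem (reduced_circle C2 redG)) mem_cat.
by case/orP=> /mapP[d ds] // [->]; right.
Qed.

(** Equal linking numbers allow a sign-preserving matching of the chords of each type. Renaming [G]
    along it gives the circles of [H] up to order, and order is immaterial on odd circles. *)
Lemma reduced_Xi_equiv (G H : gauss_diagram) :
  odd_diagram H -> reduced G -> reduced H ->
  lk G C1 C2 = lk H C1 C2 -> lk G C2 C1 = lk H C2 C1 ->
  Xi_equiv_diagrams G H.
Proof.
move=> oH redG redH lk12 lk21.
have signs i : [seq c.2 | c <- nonself G i] = [seq c.2 | c <- nonself H i].
  apply: eq_constant_signs.
  - move=> c d; rewrite !mem_filter => /andP[cT _] /andP[dT _].
    by have [_ /(_ i c d)] := redG; apply.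
  - move=> c d; rewrite !mem_filter => /andP[cT _] /andP[dT _].
    by have [_ /(_ i c d)] := redH; apply.
  - by rewrite !big_filter; case: i.
pose l (D : code) := nonself D C1 ++ nonself D C2.
(* [f] matches chords at equal positions of the two lists; the default [c] is never returned on
   chords of [G], the lists having equal length. *)
pose f c := nth c (l H) (index c (l G)).
have sz i : size (nonself G i) = size (nonself H i).
  by have /(congr1 size) := signs i; rewrite !size_map.
have szl : size (l G) = size (l H) by rewrite !size_cat !sz.
have fl : map f (l G) = l H.
  case lHE : (l H) => [|c0 r]; first by move: szl; rewrite lHE => /size0nil->.
  apply: (@eq_from_nth _ c0); rewrite -lHE ?size_map // => k kG.
  rewrite (nth_map c0) // /f index_uniq ?uniq_nonself //.
  by apply: set_nth_default; rewrite -szl.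
have fnonself i : map f (nonself G i) = nonself H i.
  move: fl; rewrite map_cat => /eqP; rewrite eqseq_cat ?size_map //.
  by case/andP=> /eqP f1 /eqP f2; case: i.
have finj : {in chords G &, injective f}.
  move=> c d /(mem_nonself redG) cG /(mem_nonself redG) dG fcd.
  have idx b : b \in l G -> (index b (l G) < size (l H))%N by rewrite -szl index_mem.
  (* [f c] and [f d] use different defaults; [nth_uniq] needs a common one. *)
  have fcd' : nth d (l H) (index c (l G)) = nth d (l H) (index d (l G)).
    by rewrite (set_nth_default c) ?idx.
  have /eqP e : index c (l G) == index d (l G).
    by rewrite -(nth_uniq d (idx c cG) (idx d dG) (uniq_nonself H)) -/(l H) fcd'.
  by rewrite -(nth_index c cG) [index _ _]e nth_index.
have fsign : {in chords G, forall c, sign (f c) = sign c}.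
  move=> c /(mem_nonself redG) cG.
  have : map (snd \o f) (l G) = map snd (l G).
    by rewrite map_comp fl !map_cat !signs.
  by move=> /eq_in_map/(_ c cG) /= fc; rewrite /sign fc.
pose g (e : endpoint) := (f e.1, e.2).
have GH i : perm_eq (circle H i) (circle (map_code g G) i).
  rewrite circle_map perm_sym (perm_trans (perm_map g (reduced_circle i redG))) //.
  rewrite map_cat -!map_comp perm_sym (perm_trans (reduced_circle i redH)) //.
  by rewrite -!fnonself -!map_comp.
(* The renamed diagram inherits well-formedness from [H], whose endpoints it shares. *)
have wfK := perm_wf (perm_endpoints GH) (gd_wf H).
apply: (@rst_trans _ _ _ (GaussDiagram wfK)).
  apply: rst_step; left; left; exists 0%N, 0%N, f; split=> //.
  by rewrite !rot0.
by apply: rst_sym; apply: perm_Xi_equiv => // i; rewrite odd_circle.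
Qed.

Theorem theorem1p2 (L L' : virtual_link) (oddL : odd_link L) (oddL' : odd_link L') :
  Xi_equiv L L' <-> (Lk L C1 C2 = Lk L' C1 C2 /\ Lk L C2 C1 = Lk L' C2 C1).
Proof.
split=> [[G [G' [<- <- GG']]]|[lk12 lk21]].
  by rewrite !Lk_link_of // !(Xi_lk _ GG').
(* [Lk] is read off [repr], so [oddL] unfolds to [odd_diagram (repr L)], and likewise for [L']. *)
have [G LG redG] := Xi_reduce oddL; have [G' LG' redG'] := Xi_reduce oddL'.
have GG' : Xi_equiv_diagrams G G'.
  apply: reduced_Xi_equiv => //; first by rewrite -(Xi_odd_diagram LG').
    by rewrite -(Xi_lk _ LG) // -(Xi_lk _ LG').
  by rewrite -(Xi_lk _ LG) // -(Xi_lk _ LG').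
exists (repr L), (repr L'); rewrite /link_of !reprK; split=> //.
by apply: rst_trans LG _; apply: rst_trans GG' _; apply: rst_sym.
Qed.
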